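(* For all integers $n\geq 5$, \[ \mathrm{La}(n,B,\#P_2)=\left\lceil\frac{n}{2}\right\rceil\binom{n}{\lfloor n/2\rfloor}. \] Moreover, if $n\geq 7$, then equality (i.e. a $B$-free family $\mathcal{F}\subseteq 2^{[n]}$ containing exactly $\lceil n/2\rceil\binom{n}{\lfloor n/2\rfloor}$ copies of $P_2$) is only achieved by $\mathcal{F}=\binom{[n]}{\lfloor n/2\rfloor}\cup\binom{[n]}{\lfloor n/2\rfloor+1}$ or $\mathcal{F}=\binom{[n]}{\lceil n/2\rceil-1}\cup\binom{[n]}{\lceil n/2\rceil}$.
   Context: $[n]=\{1,\dots,n\}$, $2^{[n]}$ is the Boolean lattice of all subsets of $[n]$ ordered by inclusion, and $\binom{[n]}{k}$ is the set of $k$-element subsets of $[n]$. A poset $P$ is a (weak) subposet of a poset $Q$ if there is an injection $f:P\to Q$ such that $p\le_P p'$ implies $f(p)\le_Q f(p')$. A family $\mathcal{F}\subseteq 2^{[n]}$ is $P$-free if $P$ is not a weak subposet of $(\mathcal{F},\subseteq)$. $P_k$ denotes the chain on $k$ elements; a copy of $P_k$ in $\mathcal{F}$ is a $k$-chain $F_1\subsetneq F_2\subsetneq\cdots\subsetneq F_k$ of members of $\mathcal{F}$ (so copies of $P_2$ are pairs $F\subsetneq F'$ in $\mathcal{F}$). $\mathrm{La}(n,P,\#Q)$ denotes the maximum number of copies of $Q$ in a $P$-free family $\mathcal{F}\subseteq 2^{[n]}$. The butterfly poset $B=K_{2,2}$ consists of four distinct elements $p_1,p_2,q_1,q_2$ with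 $p_1<q_1$, $p_1<q_2$, $p_2<q_1$, $p_2<q_2$ (and no other required relations; being a weak subposet, extra relations in the host are allowed). *)

(* Defs.v *)
From HB Require Import structures.
From mathcomp Require Import all_boot all_order.

Set Implicit Arguments.
Unset Strict Implicit.
Unset Printing Implicit Defensive.

Import Order.TTheory.

(* The ground set [n] is 'I_n; a family of subsets of [n] is a term of type
   {set {set 'I_n}}. *)

(* f is an injection of P into F with p <= q -> f p \subset f q; the converse
   implication is not required (weak subposets). *)
Definition weak_embedding (d : Order.disp_t) (P : finPOrderType d) (n : nat)
    (F : {set {set 'I_n}}) (f : {ffun P -> {set 'I_n}}) : bool :=
  [&& injectiveb f, [forall p, f p \in F]
    & [forall p, forall q, (p <= q)%O ==> (f p \subset f q)]].

Definition poset_free (d : Order.disp_t) (P : finPOrderType d) (n : nat)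
    (F : {set {set 'I_n}}) : bool :=
  ~~ [exists f : {ffun P -> {set 'I_n}}, weak_embedding F f].

(* A copy of Q in F is a subfamily of F that is the image of a weak embedding,
   so that embeddings with the same image are counted once. When Q is a chain,
   the embedding is determined by its image, and copies are k-chains. *)
Definition copies (d : Order.disp_t) (Q : finPOrderType d) (n : nat)
    (F : {set {set 'I_n}}) : {set {set {set 'I_n}}} :=
  [set [set f x | x : Q] | f : {ffun Q -> {set 'I_n}} & weak_embedding F f].

Definition La (n : nat) (dP dQ : Order.disp_t)
    (P : finPOrderType dP) (Q : finPOrderType dQ) : nat :=
  \max_(F : {set {set 'I_n}} | poset_free P F) #|copies Q F|.

(* 'I_k carries the canonical linear order. *)
Definition chain (k : nat) := 'I_k.
HB.instance Definition _ (k : nat) := Order.FinPOrder.on (chain k).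

(* The first component is the level: (false, _) are the two minimal elements
   p_1, p_2 and (true, _) the two maximal elements q_1, q_2. *)
Definition butterfly := (bool * bool)%type.
HB.instance Definition _ := Finite.on butterfly.

Definition butterfly_le (x y : butterfly) : bool := (x == y) || (~~ x.1 && y.1).

Fact butterfly_display : Order.disp_t. Proof. exact: Order.Disp tt tt. Qed.

Fact butterfly_le_refl : reflexive butterfly_le.
Proof. by case=> [[] []]. Qed.

Fact butterfly_le_anti : antisymmetric butterfly_le.
Proof. by case=> [[] []] [[] []]. Qed.

Fact butterfly_le_trans : transitive butterfly_le.
Proof. by case=> [[] []] [[] []] [[] []]. Qed.

HB.instance Definition _ :=
  Order.Le_isPOrder.Build butterfly_display butterfly
    butterfly_le_refl butterfly_le_anti butterfly_le_trans.

Definition layer (n k : nat) : {set {set 'I_n}} :=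
  [set A : {set 'I_n} | #|A| == k].

Lemma card_copies_chain2 (n : nat) (F : {set {set 'I_n}}) :
  #|copies (chain 2) F|
  = #|[set A : {set 'I_n} * {set 'I_n} |
       [&& A.1 \in F, A.2 \in F & A.1 \proper A.2]]|.
Proof.
set S := [set A | _].
have hinj : {in S &, injective
    (fun A : {set 'I_n} * {set 'I_n} => [set A.1; A.2])}.
  move=> [A B] [C D]; rewrite !inE /= => /and3P[_ _ pAB] /and3P[_ _ pCD] e.
  have : A \in [set C; D] by rewrite -e !inE eqxx.
  have : B \in [set C; D] by rewrite -e !inE eqxx orbT.
  rewrite !inE => /orP[] /eqP eB /orP[] /eqP eA; subst=> //.
  - by rewrite properxx in pAB.
  - by move: (proper_trans pAB pCD); rewrite properxx.
  - by rewrite properxx in pAB.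
rewrite -(card_in_imset hinj); congr #|pred_of_set _|; apply/setP=> G.
apply/imsetP/imsetP=> [[f]|[[A B]]].
  rewrite inE => /and3P[/injectiveP fi /forallP fF /forallP fm] ->.
  exists (f ord0, f ord_max).
    rewrite inE /= !fF /= properEneq; apply/andP; split.
      by apply/eqP=> /fi.
    by have /forallP/(_ ord_max)/implyP := fm ord0; apply.
  apply/setP=> X; rewrite !inE /=; apply/imsetP/orP=> [[i _ ->]|].
    case: i => [[|[|i]] hi] //; [left|right]; apply/eqP; congr (f _); exact: val_inj.
  by case=> /eqP ->; [exists ord0 | exists ord_max].
rewrite inE /= => /and3P[AF BF pAB] ->.
pose f : {ffun chain 2 -> {set 'I_n}} :=
  [ffun i : chain 2 => if i == ord0 then A else B].
have nAB : A != B by move: pAB; rewrite properEneq => /andP[].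
exists f.
  rewrite inE; apply/and3P; split.
  - apply/injectiveP => -[[|[|i]] hi] // [[|[|j]] hj] //; rewrite !ffunE /=;
      try by move=> _; apply: val_inj.
      by move/eqP; rewrite (negbTE nAB).
    by move/eqP; rewrite eq_sym (negbTE nAB).
  - by apply/forallP=> i; rewrite ffunE; case: ifP.
  apply/forallP=> -[[|[|i]] hi] //; apply/forallP=> -[[|[|j]] hj] //;
    apply/implyP; rewrite !ffunE //= => _; exact: proper_sub.
apply/setP=> X; rewrite !inE; apply/orP/imsetP=> [|[i _ ->]].
  by case=> /eqP ->; [exists ord0 | exists ord_max]; rewrite // ffunE.
by rewrite ffunE; case: ifP; [left|right].
Qed.

(* Main.v *)
Require Import Defs.
From mathcomp Require Import all_boot all_order zify.

Set Implicit Arguments.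
Unset Strict Implicit.
Unset Printing Implicit Defensive.

(* An edge of the cube is a pair [(C, x)] with [x \notin C], standing for the
   cover [C < x |: C]. If no maximal chain contains two edges of [E], then
   the numbers [#|C|! (n - #|C| - 1)!] of maximal chains through the edges of
   [E] sum to at most [n!]; each of these numbers is minimal at the middle,
   where it is [w], and [uphalf n * 'C(n, n./2) * w = n!].

   Let [F] be butterfly-free. A member of [F] with members both below and above
   it (a middle element) has exactly one of each. Among the other members let
   the lower ones have something above and the upper ones something below.
   For every set [C], at most one lower set lies in [C] or at most one upper
   set contains [C]. Hence every path from a lower [A] to an upper [B] has an
   edge [(C, x)] such that [A] is the only lower set in [C] and [B] the only
   upper set over [x |: C], so that the edge determines the pair. Taking the
   first such edges for the pairs [A < B] with no middle element in between,
   and all edges into the middle elements, no two lie on a common chain. Each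
   middle element accounts for at most three pairs, and at least
   [uphalf n * w] chains pass through it, which gives the bound as soon as
   [3 <= uphalf n].

   If equality holds and [4 <= uphalf n], then there is no middle element and
   each pair has a single edge, hence consists of consecutive sets; moreover
   no edge can be added to the system, so that the lower and upper sets are
   closed under adding, resp. removing, any element: they form two layers. *)

(** * Chain-independent sets of edges of the cube *)

Section CubeEdges.
Variable T : finType.
Implicit Types (X C : {set T}) (e : {set T} * T) (E : {set {set T} * T}).

Definition edge_top e : {set T} := e.2 |: e.1.

Definition edge_weight e : nat := #|e.1|`! * (#|T| - #|e.1|.+1)`!.

(** Two distinct edges lie on a common maximal chain exactly when the top of one is contained in the
    bottom of the other; for [e = e'] the second clause follows from the first. *)
Definition chain_independent E : Prop :=
  (forall e, e \in E -> e.2 \notin e.1) /\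
  (forall e e', e \in E -> e' \in E -> ~~ (edge_top e \subset e'.1)).

Lemma card_edge_top e : e.2 \notin e.1 -> #|edge_top e| = #|e.1|.+1.
Proof. by move=> xC; rewrite /edge_top cardsU1 xC. Qed.

(* Both sides count the maximal chains of [set0, X] through the edge [e],
   split on the right by their coatom [X :\ x]. *)
Lemma edge_weight_coatoms e X : e.2 \notin e.1 -> edge_top e \subset X ->
  #|e.1|`! * (#|X| - #|e.1|.+1)`!
  = \sum_(x in X) ((e == (X :\ x, x)) * #|X|.-1`!
      + (edge_top e \subset X :\ x) * (#|e.1|`! * (#|X :\ x| - #|e.1|.+1)`!)).
Proof.
move=> xC sX; have cT := card_edge_top xC.
have [eX|neX] := eqVneq (edge_top e) X.
  have e2X : e.2 \in X by rewrite -eX setU11.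
  have eE : e = (X :\ e.2, e.2).
    by rewrite -eX /edge_top setU1K //; case: (e).
  have cX : #|X| = #|e.1|.+1 by rewrite -eX.
  rewrite cX subnn fact0 muln1 (bigD1 e.2) //= -eE eqxx mul1n.
  rewrite (_ : edge_top e \subset _ = false); last first.
    by apply/negbTE/subsetPn; exists e.2; rewrite ?setU11 // !inE eqxx.
  rewrite mul0n addn0 big1 ?addn0 //= => x /andP[xX xe].
  rewrite (_ : e == _ = false); last first.
    by apply/eqP=> e2; move: xe; rewrite e2 eqxx.
  rewrite (_ : edge_top e \subset _ = false) //.
  by rewrite eX; apply/negbTE/subsetPn; exists x; rewrite // !inE eqxx.
have pX : edge_top e \proper X by rewrite properEneq neX.
have ltX := proper_card pX; rewrite cT in ltX.
rewrite (big_setID (edge_top e)) /= (setIidPr sX) big1 ?add0n; last first.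
  move=> x xe; rewrite (_ : edge_top e \subset _ = false); last first.
    by apply/negbTE/subsetPn; exists x; rewrite // !inE eqxx.
  rewrite (_ : e == _ = false) //; apply/eqP=> eE; move/eqP: neX; apply.
  by rewrite /edge_top eE /= setD1K // (subsetP sX).
rewrite (eq_bigr (fun=> #|e.1|`! * (#|X| - #|e.1|.+2)`!)); last first.
  move=> x; rewrite inE => /andP[xe xX].
  rewrite (_ : e == _ = false); last first.
    by apply/eqP=> eE; move: xe; rewrite eE setU11.
  rewrite subsetD1 sX xe mul1n mul0n add0n; congr (_ * _`!).
  by have := cardsD1 x X; rewrite xX; lia.
rewrite sum_nat_const cardsD (setIidPr sX) cT mulnCA; congr (_ * _).
have -> : #|X| - #|e.1|.+1 = (#|X| - #|e.1|.+2).+1 by lia.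
exact: factS.
Qed.

(** Induction on [#|X|] through the coatoms [X :\ x]. If [(X :\ x, x)] is in [E], independence
    leaves no edge of [E] inside [X :\ x]; otherwise the induction hypothesis applies. Either way
    the coatom contributes at most the factorial of [#|X|.-1]. *)
Lemma sum_chain_independent_sub E X : chain_independent E ->
  \sum_(e in E | edge_top e \subset X) #|e.1|`! * (#|X| - #|e.1|.+1)`!
  <= #|X|`!.
Proof.
move=> [Enin Eind]; have [k] := ubnP #|X|; elim: k X => // k IH X ltk.
under eq_bigr => e /andP[eE eX] do rewrite edge_weight_coatoms ?Enin //.
rewrite exchange_big /=.
have [->|[x0 x0X]] := set_0Vmem X; first by rewrite big_set0.
have cX : 0 < #|X| by apply/card_gt0P; exists x0.
apply: (@leq_trans (\sum_(x in X) #|X|.-1`!)); last first.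
  by rewrite sum_nat_const -{1}(prednK cX) -factS prednK.
apply: leq_sum => x xX; have cXx : #|X :\ x| = #|X|.-1.
  by have := cardsD1 x X; rewrite xX; lia.
rewrite big_split /=.
have sub e : (e \in E) && (edge_top e \subset X :\ x) ->
    (e \in E) && (edge_top e \subset X).
  by case/andP=> -> /subset_trans -> //; exact: subD1set.
have low : \sum_(e | (e \in E) && (edge_top e \subset X))
     (edge_top e \subset X :\ x) * (#|e.1|`! * (#|X :\ x| - (#|e.1|).+1)`!)
   = \sum_(e in E | edge_top e \subset X :\ x)
        #|e.1|`! * (#|X :\ x| - (#|e.1|).+1)`!.
  rewrite [RHS]big_mkcond [LHS]big_mkcond /=; apply: eq_bigr => e _.
  have := sub e; case: (e \in E) => //=.
  by case: (edge_top e \subset X :\ x) => [->|_] //; rewrite ?mul1n //; case: ifP.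
rewrite low.
have [xE|xE] := boolP ((X :\ x, x) \in E).
  rewrite [X in _ + X]big1 ?addn0; last first.
    by move=> e /andP[eE es]; have := Eind _ _ eE xE; rewrite /= es.
  rewrite (bigD1 (X :\ x, x)) /=; last by rewrite xE /edge_top /= setD1K.
  by rewrite eqxx mul1n big1 ?addn0 // => e /andP[_ /negbTE->].
rewrite big1 ?add0n; last first.
  move=> e /andP[eE _]; case: eqP => // ee; by rewrite -ee eE in xE.
by rewrite -cXx; apply: IH; lia.
Qed.

Lemma sum_chain_independent E : chain_independent E ->
  \sum_(e in E) edge_weight e <= #|T|`!.
Proof.
move=> Ei; have := sum_chain_independent_sub setT Ei; rewrite cardsT.
by under eq_bigl => e do rewrite subsetT andbT.
Qed.

Lemma edge_weight_gt0 e : 0 < edge_weight e.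
Proof. by rewrite muln_gt0 !fact_gt0. Qed.

(* Otherwise [e] could be added to [E]. *)
Lemma chain_independent_saturated E e : chain_independent E ->
    \sum_(e' in E) edge_weight e' = #|T|`! -> e.2 \notin e.1 ->
  [\/ e \in E,
      exists2 e', e' \in E & edge_top e' \subset e.1
    | exists2 e', e' \in E & edge_top e \subset e'.1].
Proof.
move=> [Enin Eind] Emax ee.
have [|eE] := boolP (e \in E); first by constructor.
have [/exists_inP[e' ? ?]|/exists_inPn lo] :=
  boolP [exists e' in E, edge_top e' \subset e.1]; first by constructor; exists e'.
have [/exists_inP[e' ? ?]|/exists_inPn hi] :=
  boolP [exists e' in E, edge_top e \subset e'.1].
  by constructor 3; exists e'.
have /sum_chain_independent : chain_independent (e |: E).
  split=> [e'|e1 e2]; rewrite !inE.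
    by case/orP=> [/eqP->|/Enin].
  case/orP=> [/eqP->|e1E] /orP[/eqP->|e2E].
  - by apply/subsetPn; exists e.2; rewrite ?setU11.
  - exact: hi.
  - exact: lo.
  - exact: Eind.
by rewrite big_setU1 //= Emax leqNgt -{1}[#|T|`!]add0n ltn_add2r edge_weight_gt0.
Qed.

(** The [#|X|] edges with top [X] share out the maximal chains through [X]; the empty set is the top
    of no edge, whence the factor [0 < #|X|]. *)
Lemma sum_edges_into (H : {set {set T}}) :
  \sum_(e : {set T} * T | (e.2 \notin e.1) && (edge_top e \in H)) edge_weight e
  = \sum_(X in H) (0 < #|X|) * (#|X|`! * (#|T| - #|X|)`!).
Proof.
rewrite (partition_big edge_top (mem H)) /=; last by move=> e /andP[].
apply: eq_bigr => X XH.
rewrite (reindex_onto (fun x => (X :\ x, x)) snd) /=; last first.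
  move=> e /andP[/andP[eE _] /eqP <-]; rewrite /edge_top setU1K //; by case: (e).
rewrite (eq_bigl (fun x => x \in X)); last first.
  move=> x; rewrite /edge_top /= !inE eqxx /= andbT.
  apply/andP/idP=> [[_ /eqP <-]|xX]; first exact: setU11.
  by rewrite setD1K // XH.
rewrite (eq_bigr (fun=> #|X|.-1`! * (#|T| - #|X|)`!)) => [|x xX].
  rewrite sum_nat_const mulnA; case: #|X| => [//|k].
  by rewrite -factS mul1n.
by rewrite /edge_weight /= (cardsD1 x X) xX.
Qed.

(** Exchanging some [y] in [A :\: X] for some [x] in [X :\: A] brings [A] closer to [X]. *)
Lemma swap_closed_layer (H : {set {set T}}) (A : {set T}) :
    (forall C x y, C \in H -> x \notin C -> y \in x |: C ->
      (x |: C) :\ y \in H) ->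
  A \in H -> forall X, #|X| = #|A| -> X \in H.
Proof.
move=> Hswap AH X; have [k] := ubnP #|X :\: A|.
elim: k A AH => // k IH A AH ltk cX.
have [sXA|[x]] := set_0Vmem (X :\: A).
  suff -> : X = A by [].
  by apply/eqP; rewrite eqEcard cX leqnn andbT -setD_eq0 sXA.
rewrite inE => /andP[xA xX].
have [sAX|[y]] := set_0Vmem (A :\: X).
  have /eqP AX : A == X by rewrite eqEcard cX leqnn andbT -setD_eq0 sAX.
  by rewrite AX xX in xA.
rewrite inE => /andP[yX yA].
have yxA : y \in x |: A by rewrite inE yA orbT.
apply: (IH _ (Hswap _ _ _ AH xA yxA)).
  have : X :\: ((x |: A) :\ y) \proper X :\: A.
    apply/properP; split; last by exists x; rewrite !inE ?xA // eqxx (contraNneq _ yX) //; move=> <-.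
    apply/subsetP=> z; rewrite !inE negb_and negbK negb_or => /andP[/orP[/eqP->|/andP[_ ->]] zX //].
    by rewrite zX in yX.
  by move/proper_card; lia.
have := cardsD1 y (x |: A); rewrite yxA cardsU1 xA; lia.
Qed.

Lemma ex_subset_card (X : {set T}) k : k <= #|X| ->
  exists2 Y : {set T}, Y \subset X & #|Y| = k.
Proof.
rewrite -bin_gt0 -cards_draws => /card_gt0P[Y]; rewrite inE => /andP[? /eqP ?].
by exists Y.
Qed.

Lemma ex_superset_card (X : {set T}) k : #|X| <= k <= #|T| ->
  exists2 Y : {set T}, X \subset Y & #|Y| = k.
Proof.
move=> /andP[Xk kT]; have cX := cardsC X.
have [|Y YX cY] := @ex_subset_card (~: X) (#|T| - k); first by lia.
exists (~: Y); first by rewrite -setCS setCK.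
by have := cardsC Y; lia.
Qed.

End CubeEdges.

(** * Products of two factorials with a fixed sum of arguments *)

Lemma leq_fact_mul_balance k a d : a + k <= d ->
  (a + k)`! * d`! <= a`! * (d + k)`! ?= iff (k == 0).
Proof.
elim: k => [|k IH] le; first by rewrite !addn0; apply/leqif_refl.
have lt : (a + k.+1)`! * d`! < a`! * (d + k.+1)`!.
  rewrite !addnS !factS -mulnA [a`! * _]mulnCA.
  have [|IHle _] := IH; first by lia.
  apply: (@leq_ltn_trans ((a + k).+1 * (a`! * (d + k)`!))).
    by rewrite leq_mul2l IHle orbT.
  by rewrite ltn_pmul2r ?muln_gt0 ?fact_gt0 //; lia.
by split; [exact: ltnW | rewrite ltn_eqF].
Qed.

Lemma leq_fact_mul_mid a b c d : a + b = c + d -> c <= d <= c.+1 ->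
  c`! * d`! <= a`! * b`! ?= iff ((a == c) || (a == d)).
Proof.
move=> e /andP[cd dc].
have [ac|ca] := leqP a c.
  have [|le1 le2] := @leq_fact_mul_balance (c - a) a d; first by lia.
  rewrite (_ : a + (c - a) = c) in le1 le2; last by lia.
  rewrite (_ : d + (c - a) = b) in le1 le2; last by lia.
  by split=> //; rewrite le2; lia.
(* Since [d <= c.+1], [c < a] forces [b <= c], and [b] takes the role of [a]. *)
have [|le1 le2] := @leq_fact_mul_balance (c - b) b d; first by lia.
rewrite (_ : b + (c - b) = c) in le1 le2; last by lia.
rewrite (_ : d + (c - b) = a) in le1 le2; last by lia.
rewrite [a`! * _]mulnC.
by split=> //; rewrite le2; lia.
Qed.

(** * Lower, upper and middle members of a butterfly-free family *)

Section ButterflyFree.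
Variables (T : finType) (F : {set {set T}}).
Implicit Types (A B C M X Y : {set T}) (e : {set T} * T).

Definition butterfly_free : Prop := forall A A' B B',
  A \in F -> A' \in F -> B \in F -> B' \in F -> A != A' -> B != B' ->
  A \proper B -> A \proper B' -> A' \proper B -> A' \proper B' -> False.

Definition nested_pairs : {set {set T} * {set T}} :=
  [set p | [&& p.1 \in F, p.2 \in F & p.1 \proper p.2]].

Definition has_below X := [exists A in F, A \proper X].
Definition has_above X := [exists B in F, X \proper B].
Definition lower := [set X in F | ~~ has_below X && has_above X].
Definition upper := [set X in F | has_below X && ~~ has_above X].
Definition middle := [set X in F | has_below X && has_above X].
Definition lower_in X := [set A in lower | A \subset X].
Definition upper_over X := [set B in upper | X \subset B].

Lemma in_lower_in A X : (A \in lower_in X) = (A \in lower) && (A \subset X).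
Proof. exact: in_set. Qed.

Lemma in_upper_over B X : (B \in upper_over X) = (B \in upper) && (X \subset B).
Proof. exact: in_set. Qed.

Lemma has_belowI A X : A \in F -> A \proper X -> has_below X.
Proof. by move=> AF AX; apply/exists_inP; exists A. Qed.

Lemma has_aboveI B X : B \in F -> X \proper B -> has_above X.
Proof. by move=> BF XB; apply/exists_inP; exists B. Qed.

Lemma lower_F A : A \in lower -> A \in F.
Proof. by rewrite inE => /andP[]. Qed.

Lemma upper_F B : B \in upper -> B \in F.
Proof. by rewrite inE => /andP[]. Qed.

Lemma middle_F M : M \in middle -> M \in F.
Proof. by rewrite inE => /andP[]. Qed.

Lemma lower_minimal A X : A \in lower -> X \in F -> ~~ (X \proper A).
Proof.
rewrite inE => /and3P[_ nb _] XF; apply: contra nb; exact: has_belowI.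
Qed.

Lemma upper_maximal B X : B \in upper -> X \in F -> ~~ (B \proper X).
Proof.
rewrite inE => /and3P[_ _ na] XF; apply: contra na; exact: has_aboveI.
Qed.

Lemma lower_proper_upper A B : A \in lower -> B \in upper -> A \subset B ->
  A \proper B.
Proof.
move=> Al Bu AB; rewrite properEneq AB andbT; apply/eqP=> eAB; subst B.
by move: Al Bu; rewrite !inE => /and3P[_ /negbTE-> _] /and3P[].
Qed.

Lemma lower_antichain A A' : A \in lower -> A' \in lower -> A \subset A' ->
  A = A'.
Proof.
move=> Al Al' s; apply/eqP; have := lower_minimal Al' (lower_F Al).
by rewrite properEneq s andbT negbK.
Qed.

Lemma upper_antichain B B' : B \in upper -> B' \in upper -> B \subset B' ->
  B = B'.
Proof.
move=> Bu Bu' s; apply/eqP; have := upper_maximal Bu (upper_F Bu').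
by rewrite properEneq s andbT negbK.
Qed.

Lemma lower_in_lower A : A \in lower -> lower_in A = [set A].
Proof.
move=> Al; apply/setP=> X; rewrite in_lower_in in_set1.
apply/andP/eqP=> [[Xl XA]|->//].
by apply: lower_antichain.
Qed.

Lemma upper_over_upper B : B \in upper -> upper_over B = [set B].
Proof.
move=> Bu; apply/setP=> X; rewrite in_upper_over in_set1.
apply/andP/eqP=> [[Xu BX]|->//].
by apply/esym/upper_antichain.
Qed.

Lemma lower_inS X Y : X \subset Y -> lower_in X \subset lower_in Y.
Proof.
move=> XY; apply/subsetP=> A; rewrite !in_lower_in => /andP[-> AX].
exact: subset_trans AX XY.
Qed.

Lemma upper_overS X Y : X \subset Y -> upper_over Y \subset upper_over X.
Proof.
move=> XY; apply/subsetP=> B; rewrite !in_upper_over => /andP[-> YB].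
exact: subset_trans XY YB.
Qed.

Hypothesis Ffree : butterfly_free.

Lemma lower_in_or_upper_over C : 1 < #|lower_in C| -> #|upper_over C| <= 1.
Proof.
move=> /card_gt1P[A [A' [+ + AA']]]; rewrite [#|upper_over C| <= 1]leqNgt !in_lower_in.
move=> /andP[Al AC] /andP[Al' AC']; apply/negP=> /card_gt1P[B [B' [+ + BB']]].
rewrite !in_upper_over => /andP[Bu CB] /andP[Bu' CB'].
have AB X Y : X \in lower -> X \subset C -> Y \in upper -> C \subset Y -> X \proper Y.
  by move=> Xl XC Yu CY; apply: lower_proper_upper => //; apply: subset_trans CY.
apply: (Ffree (lower_F Al) (lower_F Al') (upper_F Bu) (upper_F Bu')) => //;
  exact: AB.
Qed.

(** Two members below [M], together with [M] and a member above it, would form a butterfly; dually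
    for two members above. Anything below [A] is also below [M], so [A] is lower, and likewise [B]
    is upper. *)
Lemma middleP M : M \in middle -> exists A B,
  [/\ lower_in M = [set A], upper_over M = [set B],
      A \proper M /\ M \proper B,
      forall X, X \in F -> X \proper M -> X = A
    & forall X, X \in F -> M \proper X -> X = B].
Proof.
move=> Mm; have := Mm; rewrite in_set.
move=> /and3P[MF /exists_inP[A AF AM] /exists_inP[B BF MB]].
have AB := proper_trans AM MB.
have uA X : X \in F -> X \proper M -> X = A.
  move=> XF XM; apply/eqP/negPn/negP=> XA.
  apply: (Ffree XF AF MF BF XA _ XM (proper_trans XM MB) AM AB).
  by apply: contraTneq MB => ->; rewrite properxx.
have uB X : X \in F -> M \proper X -> X = B.
  move=> XF MX; apply/eqP/negPn/negP=> XB.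
  apply: (Ffree AF MF XF BF _ XB (proper_trans AM MX) AB MX MB).
  by apply: contraTneq AM => ->; rewrite properxx.
have Al : A \in lower.
  rewrite in_set AF (has_aboveI MF AM) andbT; apply/negP=> /exists_inP[X XF XA].
  by have := XA; rewrite (uA X XF (proper_trans XA AM)) properxx.
have Bu : B \in upper.
  rewrite in_set BF (has_belowI MF MB); apply/negP=> /exists_inP[X XF BX].
  by have := BX; rewrite (uB X XF (proper_trans MB BX)) properxx.
exists A, B; split=> //.
  apply/setP=> X; rewrite in_lower_in in_set1; apply/andP/eqP=> [[Xl XM]|->].
    apply: uA (lower_F Xl) _; rewrite properEneq XM andbT.
    by apply: contraTneq Xl => ->; move: Mm; rewrite !in_set => /and3P[_ -> _]; rewrite andbF.
  by rewrite Al proper_sub.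
apply/setP=> X; rewrite in_upper_over in_set1; apply/andP/eqP=> [[Xu MX]|->].
  apply: uB (upper_F Xu) _; rewrite properEneq MX andbT.
  by apply: contraTneq Xu => <-; move: Mm; rewrite !in_set => /and3P[_ _ ->]; rewrite !andbF.
by rewrite Bu proper_sub.
Qed.

(** * Special edges and the nested pairs they encode *)

Definition label e := (lower_in e.1, upper_over (edge_top e)).

(* On a maximal chain, [#|lower_in C|] grows and [#|upper_over C|] decreases;
   a special edge is where the latter drops to 1, and [label] recovers from it
   the nested pair that it stands for. *)
Definition special_edge e : bool :=
  [&& e.2 \notin e.1, #|lower_in e.1| == 1, #|upper_over (edge_top e)| == 1
    & (e.1 \in lower) || (1 < #|upper_over e.1|)].

Definition pair_edges : {set {set T} * T} :=
  [set e : {set T} * T | special_edge e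
           && [forall M in middle, (lower_in M, upper_over M) != label e]].

Definition middle_edges : {set {set T} * T} :=
  [set e : {set T} * T | (e.2 \notin e.1) && (edge_top e \in middle)].

Lemma in_middle_edges e :
  (e \in middle_edges) = (e.2 \notin e.1) && (edge_top e \in middle).
Proof. exact: in_set. Qed.

Lemma pair_edges_special e : e \in pair_edges -> special_edge e.
Proof. by rewrite in_set => /andP[]. Qed.

Lemma card1_subset_eq (I : finType) (X Y : {set I}) :
  #|X| == 1 -> #|Y| == 1 -> X \subset Y -> X = Y.
Proof. by move=> /eqP X1 /eqP Y1 s; apply/eqP; rewrite eqEcard s X1 Y1. Qed.

Lemma middle_card1 M : M \in middle ->
  (#|lower_in M| == 1) && (#|upper_over M| == 1).
Proof. by case/middleP=> A [B [-> -> _ _ _]]; rewrite !cards1. Qed.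

Lemma pair_edge_neq_middle e M : e \in pair_edges -> M \in middle ->
  lower_in M = lower_in e.1 -> upper_over M = upper_over (edge_top e) -> False.
Proof.
rewrite in_set => /andP[_ /forall_inP eM] /eM + l u.
by rewrite /label l u eqxx.
Qed.

Lemma pair_middle_edges_disjoint : [disjoint pair_edges & middle_edges].
Proof.
rewrite disjoints_subset; apply/subsetP=> e ee; rewrite in_setC in_middle_edges.
apply/negP=> /andP[_ Mm]; have /andP[l1 _] := middle_card1 Mm.
apply: (pair_edge_neq_middle ee Mm) => //; apply/esym/card1_subset_eq => //.
  by case/pair_edges_special/and4P: ee.
by apply: lower_inS; apply: subsetUr.
Qed.

(** Singletons nested by inclusion are equal, so two pair edges on a chain share their label, and
    the last clause of [special_edge] fails for the higher one. A pair edge and a middle edge on a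
    chain would share the label of the middle element, which [pair_edges] excludes. Of two nested
    middle elements, the smaller would be lower. *)
Lemma edges_chain_independent : chain_independent (pair_edges :|: middle_edges).
Proof.
split=> [e|e e'].
  by rewrite in_setU in_middle_edges => /orP[/pair_edges_special/and4P[]|/andP[]].
have sub e0 : e0.1 \subset edge_top e0 := subsetUr _ _.
rewrite !in_setU => eE eE'; apply/negP=> s.
case/orP: eE => ee; case/orP: eE' => ee'.
- have /and4P[xe l u _] := pair_edges_special ee.
  have /and4P[_ l' u' c] := pair_edges_special ee'.
  have ss := subset_trans (sub e) s.
  have ll := card1_subset_eq l l' (lower_inS ss).
  have uu := card1_subset_eq u' u (upper_overS (subset_trans s (sub e'))).
  case/orP: c => [cl|]; last first.
    by rewrite ltnNge -(eqP u) subset_leq_card // upper_overS.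
  rewrite (lower_in_lower cl) in ll.
  have : e'.1 \in lower_in e.1 by rewrite ll set11.
  rewrite in_lower_in => /andP[_ s']; have := subset_trans s s'.
  by move/subset_leq_card; rewrite card_edge_top // ltnn.
- have /and4P[_ l u _] := pair_edges_special ee.
  move: ee'; rewrite in_middle_edges => /andP[_ Mm].
  have /andP[l1 u1] := middle_card1 Mm; have st := subset_trans s (sub e').
  apply: (pair_edge_neq_middle ee Mm).
    by apply/esym/card1_subset_eq=> //; apply/lower_inS/(subset_trans (sub e)).
  by apply/card1_subset_eq=> //; apply/upper_overS.
- have /and4P[_ l u _] := pair_edges_special ee'.
  move: ee; rewrite in_middle_edges => /andP[_ Mm].
  have /andP[l1 u1] := middle_card1 Mm; have st := subset_trans s (sub e').
  apply: (pair_edge_neq_middle ee' Mm).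
    by apply/card1_subset_eq=> //; apply/lower_inS.
  by apply/esym/card1_subset_eq=> //; apply/upper_overS.
- move: ee ee'; rewrite !in_middle_edges => /andP[_ Mm] /andP[xe' Mm'].
  have pM : edge_top e \proper edge_top e'.
    apply: sub_proper_trans s _; rewrite properE sub.
    by apply/subsetPn; exists e'.2; rewrite ?setU11.
  have [A [B [lA _ _ uA _]]] := middleP Mm'.
  have : A \in lower_in (edge_top e') by rewrite lA set11.
  rewrite -(uA _ (middle_F Mm) pM) in_lower_in => /andP[].
  by move: Mm; rewrite !in_set => /and3P[_ -> _]; rewrite andbF.
Qed.

Lemma upper_over_card1 B C : B \in upper -> C \subset B ->
  #|upper_over C| <= 1 -> upper_over C = [set B].
Proof.
move=> Bu CB c1; apply/esym/eqP; rewrite eqEcard cards1 c1 andbT sub1set.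
by rewrite in_upper_over Bu.
Qed.

Lemma lower_in_card1 A C : A \in lower -> A \subset C ->
  #|lower_in C| <= 1 -> lower_in C = [set A].
Proof.
move=> Al AC c1; apply/esym/eqP; rewrite eqEcard cards1 c1 andbT sub1set.
by rewrite in_lower_in Al.
Qed.

(** Climb from [C] towards [B], adding [x] first. While several upper sets remain above, [A] is the
    only lower set inside; the climb stops when [B] alone remains, at the latest at [B] itself. The
    last clause records the first direction. *)
Lemma special_edge_step A B C x : A \in lower -> B \in upper -> A \subset C ->
    lower_in C = [set A] -> (C \in lower) || (1 < #|upper_over C|) ->
    x \in B :\: C -> C \subset B ->
  exists e, [/\ special_edge e, label e = ([set A], [set B])
              & e = (C, x) \/ x |: C \subset e.1].
Proof.
move=> Al Bu; have [k] := ubnP #|B :\: C|.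
elim: k C x => // k IH C x ltk AC lC cC; rewrite in_setD => /andP[xC xB] CB.
have xCB : x |: C \subset B by rewrite subUset sub1set xB.
have [u1|u2] := leqP #|upper_over (x |: C)| 1.
  have uB := upper_over_card1 Bu xCB u1.
  exists (C, x); split; last by left.
    by rewrite /special_edge /= xC lC /edge_top /= uB !cards1.
  by rewrite /label /edge_top /= lC uB.
have AxC : A \subset x |: C by apply: subset_trans AC (subsetUr _ _).
have l1 : #|lower_in (x |: C)| <= 1.
  by rewrite leqNgt; apply: contraL u2 => /lower_in_or_upper_over; rewrite -leqNgt.
have [BxC|[y yB]] := set_0Vmem (B :\: (x |: C)).
  have BE : x |: C = B by apply/eqP; rewrite eqEsubset xCB -setD_eq0 BxC eqxx.
  by move: u2; rewrite BE upper_over_upper // cards1.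
have [||e [es el et]] := IH (x |: C) y _ AxC (lower_in_card1 Al AxC l1) _ yB xCB.
- have : B :\: (x |: C) \proper B :\: C.
    apply/properP; split; first exact/setDS/subsetUr.
    by exists x; rewrite !in_setD ?xC ?xB // setU11.
  by move/proper_card; lia.
- by rewrite u2 orbT.
exists e; split=> //; right.
case: et => [->//|]; exact/subset_trans/subsetUr.
Qed.

Lemma special_edge_first A B x : A \in lower -> B \in upper -> A \subset B ->
    x \in B :\: A ->
  exists e, [/\ special_edge e, label e = ([set A], [set B])
              & e = (A, x) \/ x \in e.1].
Proof.
move=> Al Bu AB xBA.
have [|e [es el et]] := special_edge_step Al Bu (subxx A) (lower_in_lower Al) _ xBA AB.
  by rewrite Al.
exists e; split=> //; case: et => [|/subsetP xe]; [by left | right].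
exact/xe/setU11.
Qed.

Lemma special_edge_two A B : A \in lower -> B \in upper -> A \subset B ->
    1 < #|B :\: A| ->
  exists e e', [/\ special_edge e, special_edge e', e != e',
     label e = ([set A], [set B]) & label e' = ([set A], [set B])].
Proof.
move=> Al Bu AB /card_gt1P[x [y [xBA yBA xy]]].
have [e [es el et]] := special_edge_first Al Bu AB xBA.
(* A climb starting with [z] ends at [(A, z)] or at an edge with [z] in its bottom, hence not at
   [e]. If [e = (A, x)], take [y]; otherwise take [e.2]. *)
have [z zBA ze] : exists2 z, z \in B :\: A & z \notin e.1 /\ e != (A, z).
  case: et => [eA|xe].
    exists y => //; rewrite eA /= xpair_eqE (negbTE xy) andbF.
    by move: yBA; rewrite in_setD => /andP[].
  have [/and4P[e2 l1 u1 _] [l u]] := (es, el).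
  have Ae : A \subset e.1.
    by have : A \in lower_in e.1 by [rewrite l set11]; rewrite in_lower_in => /andP[].
  have eB : edge_top e \subset B.
    by have : B \in upper_over (edge_top e) by [rewrite u set11]; rewrite in_upper_over => /andP[].
  exists e.2.
    rewrite in_setD (subsetP eB) ?setU11 ?andbT //.
    by apply: contra e2; apply: (subsetP Ae).
  split=> //; apply: contraTneq xe => ->.
  by move: xBA; rewrite in_setD => /andP[].
have [e' [es' el' et']] := special_edge_first Al Bu AB zBA.
exists e, e'; split=> //; case: et' => [->|ze']; first by case: ze.
by apply: contraTneq ze' => <-; case: ze.
Qed.

(** The factor 3 counts, for each middle [M], the pair with [M] below, the pair with [M] above, and
    the lower-upper pair around [M]. *)
Lemma card_nested_pairs_le :
  #|nested_pairs| <= #|label @: pair_edges| + 3 * #|middle|.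
Proof.
pose P := [set p : {set T} * {set T} |
  [&& p.1 \in lower, p.2 \in upper & p.1 \proper p.2]].
pose Q1 := [set p in nested_pairs | p.1 \in middle].
pose Q2 := [set p in nested_pairs | p.2 \in middle].
have sS : nested_pairs \subset P :|: Q1 :|: Q2.
  apply/subsetP=> p pS; rewrite !in_setU ![p \in [set _ in nested_pairs | _]]in_set pS /=.
  move: (pS); rewrite in_set => /and3P[p1F p2F pp].
  rewrite !in_set p1F p2F pp (has_aboveI p2F pp) (has_belowI p1F pp) /=.
  by case: has_below => //=; case: has_above.
have Q1P p : p \in Q1 -> [/\ p.1 \in F, p.2 \in F, p.1 \proper p.2 & p.1 \in middle].
  by rewrite in_set => /andP[]; rewrite in_set => /and3P[? ? ?] ?; split.
have Q2P p : p \in Q2 -> [/\ p.1 \in F, p.2 \in F, p.1 \proper p.2 & p.2 \in middle].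
  by rewrite in_set => /andP[]; rewrite in_set => /and3P[? ? ?] ?; split.
have cQ1 : #|Q1| <= #|middle|.
  have <- : #|fst @: Q1| = #|Q1|.
    apply: card_in_imset => -[X Y] [X' Y'] /Q1P/=[_ YF XY Xm] /Q1P/=[_ YF' XY' _].
    move=> eX; subst X'; have [A [B [_ _ _ _ uB]]] := middleP Xm.
    by rewrite (uB _ YF XY) (uB _ YF' XY').
  by apply: subset_leq_card; apply/subsetP=> X /imsetP[p /Q1P[_ _ _ +] ->].
have cQ2 : #|Q2| <= #|middle|.
  have <- : #|snd @: Q2| = #|Q2|.
    apply: card_in_imset => -[X Y] [X' Y'] /Q2P/=[XF _ XY Ym] /Q2P/=[XF' _ XY' _].
    move=> eY; subst Y'; have [A [B [_ _ _ uA _]]] := middleP Ym.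
    by rewrite (uA _ XF XY) (uA _ XF' XY').
  by apply: subset_leq_card; apply/subsetP=> X /imsetP[p /Q2P[_ _ _ +] ->].
have cP : #|P| <= #|label @: pair_edges| + #|middle|.
  pose sing p : {set {set T}} * {set {set T}} := ([set p.1], [set p.2]).
  have <- : #|sing @: P| = #|P|.
    by apply: card_imset => -[X Y] [X' Y'] [/set1_inj -> /set1_inj ->].
  apply: (@leq_trans #|(label @: pair_edges) :|:
            [set (lower_in M, upper_over M) | M in middle]|); last first.
    by rewrite (leq_trans (leq_card_setU _ _)) // leq_add2l leq_imset_card.
  apply: subset_leq_card; apply/subsetP=> _ /imsetP[[A B] + ->].
  rewrite in_set /= => /and3P[Al Bu AB]; rewrite in_setU /sing /=.
  have [//|nM] := boolP (_ \in [set (lower_in M, upper_over M) | M in middle]).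
    by rewrite orbT.
  have /properP[sAB [x xB xA]] := AB.
  have [|e [es el _]] := special_edge_first (x := x) Al Bu sAB.
    by rewrite in_setD xA.
  rewrite orbF -el; apply: imset_f; rewrite in_set es; apply/forall_inP=> M Mm.
  by apply: contraNneq nM => eM; rewrite -el -eM; apply: imset_f.
apply: leq_trans (subset_leq_card sS) (leq_trans (leq_card_setU _ _) _).
rewrite !mulSn mul0n addn0 !addnA; apply: leq_add cQ2.
exact: leq_trans (leq_card_setU _ _) (leq_add cP cQ1).
Qed.

End ButterflyFree.

(* Number of maximal chains through an edge between two middle layers. *)
Definition mid_weight n : nat := (uphalf n).-1`! * n./2`!.

Lemma mid_weight_gt0 n : 0 < mid_weight n.
Proof. by rewrite muln_gt0 !fact_gt0. Qed.

Lemma uphalf_mid_weight n : 0 < n -> uphalf n * mid_weight n = n./2`! * (uphalf n)`!.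
Proof.
case: n => // n _; rewrite mulnA [uphalf n.+1]uphalfE /= mulnC; congr (_ * _).
Qed.

(** Each maximal chain uses exactly one of the [uphalf n * 'C(n, n./2)] edges going up from layer
    [n./2]. *)
Lemma bin_mid_weight n : 0 < n ->
  uphalf n * 'C(n, n./2) * mid_weight n = n`!.
Proof.
move=> n0; rewrite mulnAC uphalf_mid_weight // mulnC.
have e : n - n./2 = uphalf n by lia.
by rewrite -(@bin_fact n n./2) ?e //; lia.
Qed.

(** * The upper bound by weighing edges *)

Section Extremal.
Variables (T : finType) (F : {set {set T}}).
Hypothesis Ffree : butterfly_free F.
Let n := #|T|.
Implicit Types (A B C M X Y : {set T}) (e : {set T} * T).

(** The factorial arguments sum to [n - 1], whose balanced split is [(uphalf n).-1] and [n./2];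
    these coincide for odd [n]. *)
Lemma edge_weight_min e : e.2 \notin e.1 ->
  mid_weight n <= edge_weight e
    ?= iff (#|e.1| == (uphalf n).-1) || (#|e.1| == n./2).
Proof.
move=> ee; have := max_card (mem (edge_top e)).
rewrite card_edge_top // -/n => lt; apply: leq_fact_mul_mid; lia.
Qed.

Lemma vertex_weight_min X : 0 < n ->
  uphalf n * mid_weight n <= #|X|`! * (n - #|X|)`!.
Proof.
move=> n0; rewrite uphalf_mid_weight //.
have lt : #|X| <= n by exact: max_card.
have [||//] := @leq_fact_mul_mid #|X| (n - #|X|) n./2 (uphalf n); lia.
Qed.

Lemma sum_middle_edges : 0 < n ->
  #|middle F| * (uphalf n * mid_weight n)
  <= \sum_(e in middle_edges F) edge_weight e.
Proof.
move=> n0; under eq_bigl => e do rewrite in_middle_edges.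
rewrite sum_edges_into -sum_nat_const; apply: leq_sum => M Mm.
have [A [_ [_ _ [AM _] _ _]]] := middleP Ffree Mm.
by rewrite (leq_ltn_trans _ (proper_card AM)) // mul1n vertex_weight_min.
Qed.

Lemma sum_edges_le :
  \sum_(e in pair_edges F) edge_weight e
    + \sum_(e in middle_edges F) edge_weight e <= n`!.
Proof.
rewrite -bigU /=; last exact: pair_middle_edges_disjoint.
apply: leq_trans (sum_chain_independent (edges_chain_independent Ffree)).
by under [leqRHS]eq_bigl => e do rewrite in_setU.
Qed.

Lemma sum_pair_edges :
  #|pair_edges F| * mid_weight n <= \sum_(e in pair_edges F) edge_weight e.
Proof.
rewrite -sum_nat_const; apply: leq_sum => e /pair_edges_special/and4P[ee _ _ _].
by have [] := edge_weight_min ee.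
Qed.

Lemma nested_pairs_bound : 5 <= n ->
  #|nested_pairs F| <= uphalf n * 'C(n, n./2).
Proof.
move=> n5; rewrite -(leq_pmul2r (mid_weight_gt0 n)) bin_mid_weight; last by lia.
apply: leq_trans sum_edges_le.
have cN := card_nested_pairs_le Ffree.
have cL := leq_imset_card (label F) (pair_edges F).
apply: leq_trans (leq_add sum_pair_edges (sum_middle_edges _)); last by lia.
rewrite mulnA -mulnDl leq_mul2r; apply/orP; right.
(* [5 <= n] gives [3 <= uphalf n]. *)
apply: leq_trans cN (leq_add cL _); rewrite mulnC leq_mul2l; apply/orP; right; lia.
Qed.

(** * The case of equality *)

Hypothesis n7 : 7 <= n.
Hypothesis Fmax : #|nested_pairs F| = uphalf n * 'C(n, n./2).

Let w := mid_weight n.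
Let w0 : 0 < w := mid_weight_gt0 n.

Lemma extremal_middle : middle F = set0.
Proof.
have := sum_edges_le; rewrite -(@bin_mid_weight n); last by lia.
rewrite -Fmax => le.
have cN := card_nested_pairs_le Ffree.
have cL := leq_imset_card (label F) (pair_edges F).
have := leq_trans (leq_add sum_pair_edges (sum_middle_edges _)) le.
rewrite mulnA -mulnDl leq_pmul2r // => /(_ ltac:(lia)) le2.
have le3 := leq_trans le2 (leq_trans cN (leq_add cL (leqnn _))).
rewrite leq_add2l mulnC in le3.
apply/eqP; rewrite -cards_eq0; case: (posnP #|middle F|) => [//|m0].
(* A middle element would force [uphalf n <= 3], against [7 <= n]. *)
by move: le3; rewrite leq_pmul2r // leqNgt uphalfE; case/negP; lia.
Qed.

Lemma extremal_middle_edges : middle_edges F = set0.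
Proof.
by apply/setP=> e; rewrite in_middle_edges extremal_middle !in_set0 andbF.
Qed.

(** All estimates behind the bound are tight: [label] is injective on pair edges, and every pair
    edge has minimal weight on average. *)
Lemma extremal_card :
  #|label F @: pair_edges F| = #|pair_edges F| /\
  #|pair_edges F| * w = \sum_(e in pair_edges F) edge_weight e.
Proof.
have := sum_edges_le; rewrite extremal_middle_edges big_set0 addn0.
rewrite -(@bin_mid_weight n); last by lia.
rewrite -Fmax -/w => le; have lw := sum_pair_edges.
have cN := card_nested_pairs_le Ffree.
rewrite extremal_middle cards0 muln0 addn0 in cN.
have cL := leq_imset_card (label F) (pair_edges F).
have /eqP eL : #|pair_edges F| == #|nested_pairs F|.
  by rewrite eqn_leq (leq_trans cN cL) -(leq_pmul2r w0) (leq_trans lw le).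
split; first by apply/eqP; rewrite eqn_leq cL eL cN.
by apply/eqP; rewrite eqn_leq lw {1}eL le.
Qed.

Lemma extremal_sum : \sum_(e in pair_edges F) edge_weight e = n`!.
Proof.
have [cL <-] := extremal_card; rewrite -(@bin_mid_weight n); last by lia.
rewrite -Fmax; apply/eqP; rewrite eqn_mul2r; apply/orP; right.
have cN := card_nested_pairs_le Ffree.
rewrite extremal_middle cards0 muln0 addn0 cL in cN.
rewrite eqn_leq cN -(leq_pmul2r w0) (leq_trans sum_pair_edges) //.
have := sum_edges_le; rewrite extremal_middle_edges big_set0 addn0.
by rewrite -(@bin_mid_weight n) -?Fmax //; lia.
Qed.

Lemma extremal_weight e : e \in pair_edges F ->
  (#|e.1| == (uphalf n).-1) || (#|e.1| == n./2).
Proof.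
move=> eE; have /and4P[ee _ _ _] := pair_edges_special eE.
have [le <-] := edge_weight_min ee; rewrite eqn_leq le /=.
have [_ eqw] := extremal_card.
have rest : (#|pair_edges F|).-1 * w <=
    \sum_(e' in pair_edges F | e' != e) edge_weight e'.
  have -> : (#|pair_edges F|).-1 = #|[pred e' in pair_edges F | e' != e]|.
    by rewrite (cardD1 e) eE; apply: eq_card => e'; rewrite !inE andbC.
  rewrite -sum_nat_const; apply: leq_sum => e' /andP[/pair_edges_special/and4P[ee' _ _ _] _].
  by have [] := edge_weight_min ee'.
rewrite (bigD1 e) //= in eqw; rewrite -(leq_add2r ((#|pair_edges F|).-1 * w)).
apply: leq_trans (leq_add (leqnn _) rest) _; rewrite -eqw -mulSn leq_mul2r.
by apply/orP; right; rewrite prednK //; apply/card_gt0P; exists e.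
Qed.


(** A gap of two elements between [A] and [B] would give two pair edges with one label. So [B]
    exceeds [A] by one element, and the edge between them joins [A] to [B]. *)
Lemma extremal_pair_edgesP e : e \in pair_edges F ->
  e.1 \in lower F /\ edge_top e \in upper F.
Proof.
move=> eE; have /and4P[ee /cards1P[A lA] /cards1P[B uB] _] := pair_edges_special eE.
have : A \in lower_in F e.1 by rewrite lA set11.
rewrite in_lower_in => /andP[Al Ae].
have : B \in upper_over F (edge_top e) by rewrite uB set11.
rewrite in_upper_over => /andP[Bu eB].
have se : e.1 \subset edge_top e := subsetUr _ _.
have AB : A \subset B by apply: subset_trans Ae (subset_trans se eB).
have BA1 : #|B :\: A| <= 1.
  rewrite leqNgt; apply/negP=> gap.
  have [e1 [e2 [s1 s2 ne l1 l2]]] := special_edge_two Ffree Al Bu AB gap.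
  have inE1 e' : special_edge F e' -> e' \in pair_edges F.
    by move=> se'; rewrite in_set se'; apply/forall_inP=> M; rewrite extremal_middle in_set0.
  have [/eqP/imset_injP inj _] := extremal_card.
  by move/eqP: ne; apply; apply: inj; rewrite ?inE1 // l1 l2.
have cB := cardsID A B; rewrite (setIidPr AB) in cB.
have ct := card_edge_top ee; have cA := subset_leq_card Ae.
have ct' := subset_leq_card eB.
have <- : A = e.1 by apply/eqP; rewrite eqEcard Ae; lia.
have -> // : edge_top e = B by apply/eqP; rewrite eqEcard eB; lia.
Qed.

Lemma extremal_saturated e : e.2 \notin e.1 ->
  [\/ e \in pair_edges F,
      exists2 e', e' \in pair_edges F & edge_top e' \subset e.1
    | exists2 e', e' \in pair_edges F & edge_top e \subset e'.1].
Proof.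
have := edges_chain_independent Ffree; rewrite extremal_middle_edges setU0.
by move=> Ei ee; apply: chain_independent_saturated => //; exact: extremal_sum.
Qed.

Lemma proper_edge e : e.2 \notin e.1 -> e.1 \proper edge_top e.
Proof. by move=> ee; rewrite properUr // sub1set. Qed.

(** By saturation, a missing edge has a pair edge below or above it; the bottom of that edge is a
    lower set properly comparable to [A]. *)
Lemma extremal_lower_edge A x : A \in lower F -> x \notin A ->
  (A, x) \in pair_edges F.
Proof.
move=> Al xA; have := @extremal_saturated (A, x) xA.
case=> // -[e' eE' s]; have [el eu] := extremal_pair_edgesP eE'.
  have /and4P[ee' _ _ _] := pair_edges_special eE'.
  have := lower_minimal Al (lower_F el).
  by rewrite (proper_sub_trans (proper_edge ee') s).
have := lower_minimal el (lower_F Al).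
by rewrite (proper_sub_trans (proper_edge (e := (A, x)) xA) s).
Qed.

Lemma extremal_upper_edge B x : B \in upper F -> x \in B -> B :\ x \in lower F.
Proof.
move=> Bu xB; have xBx : x \notin B :\ x by rewrite setD11.
have tB : edge_top (B :\ x, x) = B by rewrite /edge_top /= setD1K.
have pB : B :\ x \proper B by have := @proper_edge (B :\ x, x) xBx; rewrite tB.
have := @extremal_saturated (B :\ x, x) xBx; rewrite tB.
case=> [eE|[e' eE' s]|[e' eE' s]].
- by have [] := extremal_pair_edgesP eE.
- have [_ eu] := extremal_pair_edgesP eE'.
  by have := upper_maximal eu (upper_F Bu); rewrite (sub_proper_trans s pB).
have [_ eu] := extremal_pair_edgesP eE'.
have /and4P[ee' _ _ _] := pair_edges_special eE'.
have := upper_maximal Bu (upper_F eu).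
by rewrite (sub_proper_trans s (proper_edge ee')).
Qed.

Lemma extremal_layers : exists k,
  (k == (uphalf n).-1) || (k == n./2) /\
  F = [set X : {set T} | #|X| == k] :|: [set X : {set T} | #|X| == k.+1].
Proof.
have [A Al] : exists A, A \in lower F.
  have /card_gt0P[p] : 0 < #|nested_pairs F|.
    by rewrite Fmax muln_gt0 bin_gt0; lia.
  rewrite in_set => /and3P[p1F p2F pp]; exists p.1.
  rewrite in_set p1F (has_aboveI p2F pp) andbT; apply/negP=> hb.
  have : p.1 \in middle F by rewrite in_set p1F hb (has_aboveI p2F pp).
  by rewrite extremal_middle in_set0.
have lowL X : #|X| = #|A| -> X \in lower F.
  (* Adding [x] leads to an upper set, and removing [y] from it back to a lower one. *)
  apply: swap_closed_layer X => // C x y Cl xC yC.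
  apply: extremal_upper_edge yC.
  by have [] := extremal_pair_edgesP (extremal_lower_edge Cl xC).
have uppL X : #|X| = #|A|.+1 -> X \in upper F.
  move=> cX; have /card_gt0P[y yX] : 0 < #|X| by rewrite cX.
  have Xy : X :\ y \in lower F.
    by apply: lowL; have := cardsD1 y X; rewrite yX cX; lia.
  have [] := extremal_pair_edgesP (extremal_lower_edge Xy (negbT (setD11 _ _))).
  by rewrite /edge_top /= setD1K.
have [x xA] : exists x, x \notin A.
  have := Al; rewrite in_set => /and3P[_ _ /exists_inP[B _ /properP[_ [x _ xA]]]].
  by exists x.
exists #|A|; split; first exact: extremal_weight (extremal_lower_edge Al xA).
apply/setP=> X; rewrite in_setU !in_set.
apply/idP/orP=> [XF|[/eqP/lowL/lower_F|/eqP/uppL/upper_F]//].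
(* A smaller member would lie below a lower set, and one of size above [#|A|.+1] would lie above an
   upper set. *)
have [lt|gt|->] := ltngtP #|X| #|A|; [|right|by left].
  have [|Y XY cY] := @ex_superset_card T X #|A|; first by rewrite ltnW ?max_card.
  have := lower_minimal (lowL Y cY) XF.
  by rewrite properEcard XY cY lt.
rewrite eqn_leq gt andbT leqNgt; apply/negP=> gt2.
have [|Y YX cY] := @ex_subset_card T X #|A|.+1; first by [].
have := upper_maximal (uppL Y cY) XF.
by rewrite properEcard YX cY gt2.
Qed.

End Extremal.

(** * Translation from the poset definitions *)

Lemma poset_free_butterflyP n (F : {set {set 'I_n}}) :
  poset_free butterfly F <-> butterfly_free F.
Proof.
split=> [/existsPn Ffree A A' B B' AF AF' BF BF' nA nB AB AB' A'B A'B'|Ffree].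
  pose f := [ffun x : butterfly =>
    if x.1 then (if x.2 then B' else B) else (if x.2 then A' else A)].
  have /negP := Ffree f; apply; apply/and3P; split.
  - have np (X Y : {set 'I_n}) : X \proper Y -> X != Y.
      by apply: contraTneq => ->; rewrite properxx.
    have := (nA, nB, np _ _ AB, np _ _ AB', np _ _ A'B, np _ _ A'B').
    move=> [[[[[/eqP ? /eqP ?] /eqP ?] /eqP ?] /eqP ?] /eqP ?].
    by apply/injectiveP=> -[[] []] [[] []]; rewrite !ffunE //= => ?; congruence.
  - by apply/forallP=> -[[] []]; rewrite ffunE.
  apply/forallP=> -[[] []]; apply/forallP=> -[[] []]; apply/implyP; rewrite !ffunE //= => _;
    exact: proper_sub.
apply/existsPn=> f; apply/negP=> /and3P[/injectiveP fi /forallP fF /forallP fm].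
have lt b c : f (false, b) \proper f (true, c).
  rewrite properEneq; apply/andP; split; first by apply/eqP=> /fi.
  by have /forallP/(_ (true, c))/implyP := fm (false, b); apply.
apply: (Ffree (f (false, false)) (f (false, true)) (f (true, false)) (f (true, true)));
  rewrite ?fF ?lt //; by apply/eqP=> /fi.
Qed.

Lemma card_copies_nested_pairs n (F : {set {set 'I_n}}) :
  #|copies (chain 2) F| = #|nested_pairs F|.
Proof. exact: card_copies_chain2. Qed.

(** * Two consecutive layers attain the bound *)

Section TwoLayers.
Variables n k : nat.
Let F := layer n k :|: layer n k.+1.

Lemma two_layers_proper (A B : {set 'I_n}) : A \in F -> B \in F ->
  A \proper B -> #|A| = k /\ #|B| = k.+1.
Proof. rewrite !inE => ? ? /proper_card; lia. Qed.

(** A [k]-set inside two distinct sets of size [k.+1] must be their intersection. *)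
Lemma two_layers_butterfly_free : butterfly_free F.
Proof.
move=> A A' B B' AF AF' BF BF' nA nB AB AB' A'B A'B'.
have [cA cB] := two_layers_proper AF BF AB.
have [cA' cB'] := two_layers_proper AF' BF' A'B'.
have cI : #|B :&: B'| <= k.
  rewrite leqNgt; apply/negP=> c.
  have BI : B :&: B' = B by apply/eqP; rewrite eqEcard subsetIl cB.
  move/eqP: nB; apply; apply/eqP; rewrite eqEcard cB cB' leqnn andbT.
  by rewrite -BI subsetIr.
have eI (X : {set 'I_n}) : #|X| = k -> X \proper B -> X \proper B' -> X = B :&: B'.
  move=> cX XB XB'; apply/eqP.
  by rewrite eqEcard subsetI !proper_sub // cX.
by move/eqP: nA; apply; rewrite (eI A) // (eI A').
Qed.

Lemma card_two_layers_pairs : #|nested_pairs F| = (n - k) * 'C(n, k).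
Proof.
pose g (p : {set 'I_n} * 'I_n) := (p.1, p.2 |: p.1).
pose Q := [set p : {set 'I_n} * 'I_n | (#|p.1| == k) && (p.2 \notin p.1)].
have -> : nested_pairs F = g @: Q.
  apply/setP=> -[A B]; apply/idP/imsetP=> [|[[C x]]].
    rewrite in_set /= => /and3P[AF BF AB].
    have [cA cB] := two_layers_proper AF BF AB.
    have /properP[sAB [x xB xA]] := AB.
    exists (A, x); first by rewrite in_set /= cA eqxx.
    congr (_, _); apply/esym/eqP.
    by rewrite eqEcard subUset sub1set xB sAB cardsU1 xA cA cB add1n leqnn.
  rewrite in_set /= => /andP[/eqP cC xC] [-> ->].
  by rewrite !inE cardsU1 xC cC !eqxx orbT /= properUr // sub1set.
rewrite card_in_imset => [|[C x] [C' x']]; last first.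
  rewrite !in_set /= => /andP[_ xC] _ [<- e].
  have : x \in x' |: C by rewrite -e setU11.
  by rewrite !inE (negbTE xC) orbF => /eqP ->.
have := cards_draws [set: 'I_n] k; rewrite cardsT card_ord mulnC => <-.
rewrite -sum_nat_const -sum1_card.
rewrite (eq_bigl (fun p : {set 'I_n} * 'I_n =>
  (p.1 \in [set A : {set 'I_n} | A \subset [set: 'I_n] & #|A| == k])
  && (p.2 \notin p.1))); last by move=> p; rewrite !inE subsetT.
rewrite -(pair_big_dep (fun A => A \in [set A : {set 'I_n} | A \subset [set: 'I_n] & #|A| == k])
  (fun (A : {set 'I_n}) x => x \notin A) (fun _ _ => 1)) /=.
apply: eq_bigr => A; rewrite inE subsetT /= => /eqP cA.
have := cardsCs (~: A); rewrite setCK cA card_ord => <-.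
by rewrite sum1_card; apply: eq_card => x; rewrite !inE.
Qed.

End TwoLayers.

Lemma card_mid_layers_pairs n k : 5 <= n ->
    (k == (uphalf n).-1) || (k == n./2) ->
  #|nested_pairs (layer n k :|: layer n k.+1)| = uphalf n * 'C(n, n./2).
Proof.
move=> n5; rewrite card_two_layers_pairs => /orP[]/eqP->; last first.
  by congr (_ * _); lia.
(* For [k = (uphalf n).-1], absorption turns the count into [uphalf n * 'C(n, uphalf n)], and
   symmetry of binomials concludes. *)
rewrite -mul_bin_left prednK; last by lia.
by rewrite -[in RHS]bin_sub; [congr (_ * 'C(_, _)); lia | lia].
Qed.

Theorem theorem3 (n : nat) (hn : 5 <= n) :
  La n butterfly (chain 2) = uphalf n * 'C(n, n./2) /\
  (7 <= n -> forall F : {set {set 'I_n}},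
     (poset_free butterfly F /\
      #|copies (chain 2) F| = uphalf n * 'C(n, n./2)) <->
     (F = layer n n./2 :|: layer n (n./2).+1 \/
      F = layer n (uphalf n).-1 :|: layer n (uphalf n))).
Proof.
split.
  apply/eqP; rewrite eqn_leq; apply/andP; split.
    apply/bigmax_leqP=> F /poset_free_butterflyP Ffree.
    have := nested_pairs_bound Ffree; rewrite card_ord.
    by rewrite card_copies_nested_pairs; apply.
  rewrite -(@card_mid_layers_pairs n n./2) ?eqxx ?orbT //.
  rewrite -card_copies_nested_pairs; apply: leq_bigmax_cond.
  by apply/poset_free_butterflyP/two_layers_butterfly_free.
move=> n7 F; rewrite card_copies_nested_pairs.
have up : layer n (uphalf n) = layer n (uphalf n).-1.+1.
  by rewrite prednK //; lia.
rewrite up; split=> [[/poset_free_butterflyP Ffree Fmax]|Flayers].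
  have := @extremal_layers _ F Ffree; rewrite card_ord => /(_ n7 Fmax)[k [+ eF]].
  by case/orP=> /eqP ek; rewrite ek in eF; [right|left].
have [k km ->] : exists2 k, (k == (uphalf n).-1) || (k == n./2) &
    F = layer n k :|: layer n k.+1.
  by case: Flayers => ->; [exists n./2 | exists (uphalf n).-1];
    rewrite ?eqxx ?orbT.
split; last exact: card_mid_layers_pairs.
exact/poset_free_butterflyP/two_layers_butterfly_free.
Qed.
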